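(* Let $m$ and $F$ be positive integers such that $m\geq 3$, $F>2m$ and $m\nmid F$. If $S\in\mathscr I(m,F)$ and $A=\{T(B)\mid B\subseteq D(S)\}$, then $[S]=\{Z([S])\cup X\mid X\in A\}$.
   Context: $\mathbb N$ denotes the non-negative integers. A numerical semigroup is a submonoid $S$ of $(\mathbb N,+)$ with $\mathbb N\setminus S$ finite. Its multiplicity $\operatorname{m}(S)$ is the smallest positive integer in $S$; its Frobenius number $\operatorname{F}(S)$ is the largest integer not in $S$. A numerical semigroup is irreducible if it cannot be expressed as the intersection of two numerical semigroups properly containing it. $\mathscr L(m,F)$ (respectively $\mathscr I(m,F)$) is the set of all numerical semigroups (respectively all irreducible numerical semigroups) with multiplicity $m$ and Frobenius number $F$. For a numerical semigroup $S$, $\theta(S)=\{s\in S\mid \operatorname{m}(S)<s<\operatorname{F}(S)/2\}$. On $\mathscr L(m,F)$, $S\sim S'$ if and only if $\theta(S)=\theta(S')$, and $[S]=\{S'\in\mathscr L(m,F)\mid S\sim S'\}$. $Z([S])=\bigcap_{S'\in[S]}S'$. For $S\in\mathscr I(m,F)$, $D(S)=S\setminus Z([S])$, and for $B\subseteq D(S)$, $T(B)=\bigcup_{b\in B}\big((\{b\}+Z([S]))\cap D(S)\big)$, where $\{b\}+Z([S])=\{b+z\mid z\in Z([S])\}$ (so $T(\varnothing)=\varnothing$). *)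

(* Defs.v *)
From mathcomp Require Import all_boot all_order all_algebra.
From mathcomp Require Import all_classical.
Set Implicit Arguments.
Unset Strict Implicit.
Unset Printing Implicit Defensive.

Import Order.TTheory GRing.Theory Num.Theory.

Local Open Scope classical_set_scope.

Definition numerical_semigroup (S : set nat) : Prop :=
  [/\ S 0%N, (forall x y, S x -> S y -> S (x + y)%N) & finite_set (~` S)].

(* The default value of [xget] is irrelevant: a numerical semigroup always
   contains a positive integer. *)
Definition multiplicity (S : set nat) : nat :=
  xget 0%N [set m | [/\ S m, (0 < m)%N &
                        forall s, S s -> (0 < s)%N -> (m <= s)%N]].

Definition int_gaps (S : set nat) : set int := ~` (Posz @` S).

(* Valued in [int], so that the Frobenius number of the whole of [nat] is -1;
   for a numerical semigroup the largest integer gap always exists, hence the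
   default value of [xget] is irrelevant. *)
Definition frobenius (S : set nat) : int :=
  xget 0%R [set f | int_gaps S f /\ ubound (int_gaps S) f].

Definition irreducible (S : set nat) : Prop :=
  numerical_semigroup S /\
  ~ exists S1 S2 : set nat,
      [/\ numerical_semigroup S1, numerical_semigroup S2,
          S `<` S1, S `<` S2 & S = S1 `&` S2].

Definition semigroups (m F : nat) : set (set nat) :=
  [set S | [/\ numerical_semigroup S, multiplicity S = m & frobenius S = Posz F]].

Definition irreducible_semigroups (m F : nat) : set (set nat) :=
  [set S | semigroups m F S /\ irreducible S].

(* The condition s < F(S)/2 is written 2s < F(S). *)
Definition theta (S : set nat) : set nat :=
  [set s | [/\ S s, (multiplicity S < s)%N & (2 * s%:Z < frobenius S)%R]].

Definition theta_class (m F : nat) (S : set nat) : set (set nat) :=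
  [set S' | semigroups m F S' /\ theta S = theta S'].

Definition class_inter (m F : nat) (S : set nat) : set nat :=
  \bigcap_(S' in theta_class m F S) S'.

Definition class_diff (m F : nat) (S : set nat) : set nat :=
  S `\` class_inter m F S.

Definition class_gen (m F : nat) (S B : set nat) : set nat :=
  \bigcup_(b in B)
    ([set (b + z)%N | z in class_inter m F S] `&` class_diff m F S).

(* Main.v *)
(** The class of [S] is closed under intersection, so [Z([S])] belongs to it,
    and all its members agree below [F/2] and miss [F/2]. If [S'] is a member,
    then [S `|` S'] is a semigroup: a sum with one summand outside [S] has a
    summand above [F/2], so either the other one lies below [F/2], hence in both
    semigroups, or the sum exceeds [F]. As [S] is the intersection of
    [S `|` S'] and [S `|` [set F]], irreducibility forces [S' `<=` S]. So the
    members are the semigroups between [Z([S])] and [S], and since the elements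
    of [D(S)] exceed [F/2], such a semigroup is just a set [Z([S]) `|` X] with
    [X `<=` D(S)] stable under the translations by [Z([S])] that remain in
    [D(S)]. *)
Require Import Defs.
From mathcomp Require Import all_boot all_order all_algebra.
From mathcomp Require Import all_classical.
From mathcomp Require Import zify.

Local Open Scope classical_set_scope.

(** Positivity of [m] excludes the default value [0] of [xget]; [frobeniusP] uses positivity of [F]
    in the same way. *)
Lemma multiplicityP (S : set nat) (m : nat) : (0 < m)%N ->
  multiplicity S = m <-> S m /\ (forall s, S s -> (0 < s)%N -> (m <= s)%N).
Proof.
move=> m0; split.
  rewrite /multiplicity; case: xgetP => [x -> [Sx _ xle] <- //|_ m0E].
  by rewrite -m0E in m0.
move=> [Sm mle]; apply: xget_unique => // y [Sy y0 yle].
by apply/eqP; rewrite eqn_leq mle // yle.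
Qed.

Lemma frobeniusP (S : set nat) (F : nat) : (0 < F)%N ->
  frobenius S = Posz F <-> ~ S F /\ (forall x, (F < x)%N -> S x).
Proof.
have gapP x : int_gaps S (Posz x) <-> ~ S x.
  by split=> [gx Sx|nSx [y Sy [xy]]]; [apply: gx; exists x|rewrite xy in Sy].
move=> F0; split.
  rewrite /frobenius; case: xgetP => [f -> [gf uf] fF|_ [F0E]]; last first.
    by rewrite -F0E in F0.
  split; first by apply/gapP; rewrite -fF.
  by move=> x Fx; apply: contrapT => /gapP /uf; rewrite fF; lia.
move=> [nSF gtF].
have ubF : ubound (int_gaps S) (Posz F).
  move=> [x /gapP nSx|//]; rewrite lez_nat leqNgt; apply/negP => /gtF.
  exact: nSx.
apply: xget_unique => [|f [gf uf]]; first by split=> //; apply/gapP.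
by apply/Order.POrderTheory.le_anti/andP; split; [exact: ubF|apply/uf/gapP].
Qed.

(** Containing every [x > F] bounds the gaps and so gives cofiniteness; what is left are elementwise
    conditions. *)
Lemma semigroupsP (m F : nat) (S : set nat) : (0 < m)%N -> (0 < F)%N ->
  semigroups m F S <->
  [/\ S 0%N, (forall x y, S x -> S y -> S (x + y)%N)
     & forall x, (F < x)%N -> S x] /\
  [/\ S m, (forall s, S s -> (0 < s)%N -> (m <= s)%N) & ~ S F].
Proof.
move=> m0 F0; split.
  by move=> [[S0 SD _] /(multiplicityP _ _ m0)[Sm mle]
    /(frobeniusP _ _ F0)[nSF gtF]].
move=> [[S0 SD gtF] [Sm mle nSF]]; split; last 2 first.
- exact/(multiplicityP _ _ m0).
- exact/(frobeniusP _ _ F0).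
split=> //; apply: (@sub_finite_set _ _ `I_F.+1) => [x nSx|].
  by rewrite /= ltnS leqNgt; apply/negP => /gtF.
exact: finite_II.
Qed.

(** [theta] only sees elements above [m], but up to [m] both semigroups consist of [0] and [m]. *)
Lemma theta_classP (m F : nat) (S T : set nat) : (0 < m)%N -> (0 < F)%N ->
  semigroups m F S ->
  theta_class m F S T <->
  semigroups m F T /\ (forall x, (2 * x < F)%N -> S x <-> T x).
Proof.
move=> m0 F0 gS; split=> -[gT ST]; split=> //; last first.
  case: (gS) (gT) => [_ mS fS] [_ mT fT].
  apply/seteqP; split=> x; rewrite /theta /= mS mT fS fT => -[Ux mx xF];
    by split=> //; apply/ST => //; lia.
have thetaE U x : semigroups m F U -> (m < x)%N -> (2 * x < F)%N ->
    U x <-> theta U x.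
  move=> [_ mU fU] mx xF; rewrite /theta /= mU fU.
  by split=> [Ux|[]//]; split=> //; lia.
case/semigroupsP: (gS) => // -[S0 _ _] [Sm Smin _].
case/semigroupsP: (gT) => // -[T0 _ _] [Tm Tmin _] x xF.
have [mx|] := ltnP m x.
  apply: iff_trans (thetaE S x gS mx xF) _.
  by rewrite ST; exact: iff_sym (thetaE T x gT mx xF).
rewrite leq_eqVlt => /predU1P[-> //|xm].
have [->//|x0] := posnP x.
by split=> [/Smin|/Tmin] /(_ x0); rewrite leqNgt xm.
Qed.

(** Memberships and closure hold in every member, hence in the intersection; minimality of [m] and
    the gap [F] come from [S] alone. *)
Lemma theta_class_inter (m F : nat) (S : set nat) : (0 < m)%N -> (0 < F)%N ->
  semigroups m F S -> theta_class m F S (class_inter m F S).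
Proof.
move=> m0 F0 gS.
have cS : theta_class m F S S by [].
have ZS : class_inter m F S `<=` S by move=> x; apply.
case/semigroupsP: (gS) => // _ [_ Smin nSF].
apply/theta_classP => //; split; last first.
  move=> x xF; split=> [Sx T /theta_classP[//|//|//|_ ST]|/ZS//].
  exact/ST.
apply/semigroupsP => //; split; split.
- by move=> T [/semigroupsP[]// []].
- move=> x y Zx Zy T cT.
  have [/semigroupsP[]// [_ TD _] _ _] := cT.
  by apply: TD; [exact: Zx|exact: Zy].
- by move=> x Fx T [/semigroupsP[]// [_ _ gtF] _ _]; exact: gtF.
- by move=> T [/semigroupsP[]// _ []].
- by move=> s /ZS; exact: Smin.
- by move=> /ZS.
Qed.

Lemma semigroup_double_neq (m F : nat) (S : set nat) (x : nat) :
  (0 < m)%N -> (0 < F)%N -> semigroups m F S -> S x -> (2 * x)%N <> F.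
Proof.
move=> m0 F0 /semigroupsP[]// [_ SD _] [_ _ nSF] Sx xF; apply: nSF.
by rewrite -xF mul2n -addnn; exact: SD.
Qed.

Lemma sub_theta_class (m F : nat) (S T : set nat) : (0 < m)%N -> (0 < F)%N ->
  irreducible_semigroups m F S -> theta_class m F S T -> T `<=` S.
Proof.
move=> m0 F0 [gS [nsS irrS]] /theta_classP[//|//|//|gT ST].
case/semigroupsP: (gS) => // -[S0 SD SgtF] [_ _ nSF].
case/semigroupsP: (gT) => // -[T0 TD TgtF] [_ _ nTF].
apply: contrapT => nTS; apply: irrS.
have STD x y : S x -> T y -> (S `|` T) (x + y)%N.
  move=> Sx Ty.
  (* Neither summand equals [F/2], so if neither lies below it, the sum strictly exceeds [F]. *)
  have := semigroup_double_neq _ _ _ _ m0 F0 gS Sx.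
  have := semigroup_double_neq _ _ _ _ m0 F0 gT Ty.
  have [xF _ _|Fx yF xF] := ltnP (2 * x) F.
    by right; apply: TD => //; apply/ST.
  have [yF'|Fy] := ltnP (2 * y) F; first by left; apply: SD => //; apply/ST.
  by left; apply: SgtF; lia.
have fin U : S `<=` U -> finite_set (~` U).
  by case: nsS => _ _ finS /subsetC SU; exact: sub_finite_set finS.
(* As [F] is not in [T], these two meet exactly in [S]. *)
exists (S `|` T), (S `|` [set F]); split.
- split; [by left| |by apply: fin; exact: subsetUl].
  move=> x y [Sx|Tx] [Sy|Ty].
  + by left; exact: SD.
  + exact: STD.
  + by rewrite addnC; exact: STD.
  + by right; exact: TD.
- split; [by left| |by apply: fin; exact: subsetUl].
  have SF x y : S x -> y = F -> (S `|` [set F]) (x + y)%N.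
    move=> Sx ->; have [->|x0] := posnP x; first by right.
    by left; apply: SgtF; lia.
  move=> x y [Sx|xF] [Sy|yF].
  + by left; exact: SD.
  + exact: SF.
  + by rewrite addnC; exact: SF.
  + by left; apply: SgtF; rewrite xF yF; lia.
- split; first exact: subsetUl.
  by move=> sTS; apply: nTS => x Tx; apply: sTS; right.
- split; first exact: subsetUl.
  by move=> sFS; apply: nSF; apply: sFS; right.
- apply/seteqP; split=> [x Sx|x [[//|Tx] [//|xF]]]; first by split; left.
  by rewrite xF in Tx.
Qed.

(** Required elements come from the lower bound, exclusions from the upper bound [S]; only additive
    closure does not follow from the inclusions. *)
Lemma theta_class_between (m F : nat) (S T : set nat) :
  (0 < m)%N -> (0 < F)%N -> semigroups m F S ->
  class_inter m F S `<=` T -> T `<=` S ->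
  (forall x y, T x -> T y -> T (x + y)%N) -> theta_class m F S T.
Proof.
move=> m0 F0 gS ZT TS TD.
have /theta_classP[//|//|//|gZ SZ] := theta_class_inter _ _ _ m0 F0 gS.
case/semigroupsP: (gS) => // _ [_ Smin nSF].
case/semigroupsP: (gZ) => // -[Z0 _ ZgtF] [Zm _ _].
apply/theta_classP => //; split; last first.
  by move=> x xF; split=> [/(SZ _ xF)/ZT|/TS].
apply/semigroupsP => //; split; split=> //.
- exact: ZT.
- by move=> x /ZgtF/ZT.
- exact: ZT.
- by move=> s /TS; exact: Smin.
- by move=> /TS.
Qed.

Lemma class_diff_gt (m F : nat) (S : set nat) (x : nat) :
  (0 < m)%N -> (0 < F)%N -> semigroups m F S ->
  class_diff m F S x -> (F < 2 * x)%N.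
Proof.
move=> m0 F0 gS [Sx nZx].
have /theta_classP[//|//|//|_ SZ] := theta_class_inter _ _ _ m0 F0 gS.
have xF := semigroup_double_neq _ _ _ _ m0 F0 gS Sx.
have [/SZ[/(_ Sx)]//|] := ltnP (2 * x) F.
by rewrite leq_eqVlt => /predU1P[/esym|].
Qed.

Theorem proposition34 (m F : nat) (S : set nat) (A : set (set nat))
    (hm : (3 <= m)%N) (hF : (2 * m < F)%N) (hmF : ~~ (m %| F)%N)
    (hS : irreducible_semigroups m F S)
    (hA : A = [set class_gen m F S B | B in [set B | B `<=` class_diff m F S]]) :
  theta_class m F S = [set class_inter m F S `|` X | X in A].
Proof.
have m0 : (0 < m)%N by lia.
have F0 : (0 < F)%N by lia.
have gS : semigroups m F S by case: hS.
have [/semigroupsP[//|//|[Z0 ZD ZgtF] _] _] :=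
  theta_class_inter _ _ _ m0 F0 gS.
have ZS : class_inter m F S `<=` S by move=> x; apply.
rewrite hA; apply/seteqP; split=> [T cT|_ [_ [B BD <-] <-]].
  have TS := sub_theta_class _ _ _ _ m0 F0 hS cT.
  have ZT : class_inter m F S `<=` T by move=> x; apply.
  have [/semigroupsP[//|//|[_ TD _] _] _] := cT.
  (* The part of [T] outside [Z([S])] generates itself: translation by [0] recovers each element,
     and closure of [T] adds nothing new. *)
  exists (class_gen m F S (T `\` class_inter m F S)).
    exists (T `\` class_inter m F S) => //.
    by move=> x [/TS Sx nZx].
  apply/seteqP; split=> x.
    by move=> [/ZT//|[b [Tb _] [[z /ZT Tz <-] _]]]; exact: TD.
  move=> Tx; have [Zx|nZx] := pselect (class_inter m F S x); [by left|right].
  exists x => //; split; last by split=> //; exact: TS.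
  by exists 0%N => //; rewrite addn0.
set Z := class_inter m F S in Z0 ZD ZgtF ZS *.
have SD x y : S x -> S y -> S (x + y)%N.
  by case/semigroupsP: gS => // -[_ SD _] _; exact: SD.
have genS : class_gen m F S B `<=` S by move=> x [b _ [_ []]].
(* A translate of [b + z] by [y] is the translate of [b] by [z + y]; it stays in [S], so it is in
   [Z] or in [D(S)]. *)
have genD x y : class_gen m F S B x -> Z y ->
    (Z `|` class_gen m F S B) (x + y)%N.
  move=> gx Zy; have Sxy : S (x + y)%N by apply: SD; [exact: genS|exact: ZS].
  have [Zxy|nZxy] := pselect (Z (x + y)%N); [by left|right].
  case: gx Sxy nZxy => b Bb [[z Zz <-] _] Sxy nZxy.
  exists b => //; split=> //.
  by exists (z + y)%N; [exact: ZD|rewrite addnA].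
have gen_gt x : class_gen m F S B x -> (F < 2 * x)%N.
  by move=> [b _ [_ Dx]]; exact: class_diff_gt Dx.
apply: (theta_class_between _ _ _ _ m0 F0 gS); [by move=> x; left| |].
  by move=> x [/ZS|/genS].
move=> x y [Zx|gx] [Zy|gy].
- by left; exact: ZD.
- by rewrite addnC; exact: genD.
- exact: genD.
(* Both summands exceed [F/2], so the sum exceeds [F]. *)
- by left; apply: ZgtF; move: (gen_gt _ gx) (gen_gt _ gy); lia.
Qed.
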